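(* There is an absolute constant $c>0$ such that for every odd prime $p$ and every split maximal torus $T\subset SL_2(\mathbb{F}_p)$ there is a choice of unit vectors $\phi_\chi\in\mathcal{H}_\chi$, $\chi\in I$, for which the discrete oscillator transform $\Theta_T:\mathbb{C}(\mathbb{F}_p)\to\mathbb{C}(I)$, $\Theta_T[f](\chi)=\langle f,\phi_\chi\rangle$, can be computed (from the values $f(x)$, $x\in\mathbb{F}_p$) in at most $c\,p\log p$ arithmetic operations.
   Context: Setting. $p$ is an odd prime, $\psi(z)=e^{2\pi i z/p}$ for $z\in\mathbb{F}_p$. $V=\mathbb{F}_p\times\mathbb{F}_p$ (column vectors $(t,w)$) carries the symplectic form $\omega((t,w),(t',w'))=tw'-wt'$. The Heisenberg group is $H=V\times\mathbb{F}_p$ with $(v,z)(v',z')=(v+v',z+z'+\tfrac12\omega(v,v'))$; $SL_2(\mathbb{F}_p)$ acts on $H$ by $g(v,z)=(gv,z)$. $\mathcal{H}=\mathbb{C}(\mathbb{F}_p)$ is the Hilbert space of complex functions on $\mathbb{F}_p$ with the standard Hermitian product. The Heisenberg representation $\pi$ of $H$ on $\mathcal{H}$ is determined by $\pi((t,0),0)[f](x)=f(x+t)$, $\pi((0,w),0)[f](x)=\psi(wx)f(x)$, $\pi(0,z)[f]=\psi(z)f$. Weil representation. $\rho:SL_2(\mathbb{F}_p)\to GL(\mathcal{H})$ is the linear representation satisfying $\rho(g)\pi(h)\rho(g)^{-1}=\pi(g(h))$ for all $g\in SL_2(\mathbb{F}_p)$, $h\in H$. It exists, and it is unique if $p\neq3$;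 for $p=3$ it denotes the canonical choice, namely the one with $\mathrm{Tr}\,\rho(g)=\sigma(-\det(\kappa(g)+I))$ whenever $g-I$ is invertible, where $\kappa(g)=(g+I)(g-I)^{-1}$ and $\sigma$ is the quadratic (Legendre) character of $\mathbb{F}_p^\times$. A split maximal torus is a subgroup of $SL_2(\mathbb{F}_p)$ conjugate to $A=\{\mathrm{diag}(a,a^{-1}):a\in\mathbb{F}_p^\times\}$. For a character $\chi$ of $T$, $\mathcal{H}_\chi=\{\phi\in\mathcal{H}:\rho(g)\phi=\chi(g)\phi\ \text{for all } g\in T\}$; $I$ is the set of characters $\chi$ of $T$ with $\mathcal{H}_\chi\neq0$; one unit vector $\phi_\chi$ is chosen for each $\chi\in I$. ''Computed in $n$ arithmetic operations'' means: by a straight-line program with $n$ steps, each an addition of two previously computed complex numbers or a multiplication of a previously computed complex number by a fixed complex constant (constants may depend on $p$, $T$ and the $\phi_\chi$ but not on $f$). *)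

(* Defs.v *)
From HB Require Import structures.
From mathcomp Require Import all_boot all_order all_algebra all_fingroup.
From mathcomp Require Import mxrepresentation.
From mathcomp Require Import complex ring.
From mathcomp Require Import all_classical all_reals all_analysis.

Set Implicit Arguments.
Unset Strict Implicit.
Unset Printing Implicit Defensive.

Import Order.TTheory GRing.Theory Num.Theory.

Local Open Scope ring_scope.

(* 'F_p is by definition the ordinal type 'I_(dimF p), so that a column vector
   f : 'cV[C]_(dimF p) is a function on 'F_p, with values f x 0, and a square
   matrix of size dimF p is a linear operator on such functions. *)
Notation dimF p := (Zp_trunc (pdiv p)).+2.

Section Heisenberg.
Variable p : nat.

Definition symp (u v : 'cV['F_p]_2) : 'F_p := u 0 0 * v 1 0 - u 1 0 * v 0 0.

Definition vec2 (t w : 'F_p) : 'cV['F_p]_2 :=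
  \col_(i < 2) (if i == 0 then t else w).

Definition heis := ('cV['F_p]_2 * 'F_p)%type.

Definition heis_mul (h k : heis) : heis :=
  (h.1 + k.1, h.2 + k.2 + 2%:R^-1 * symp h.1 k.1).
Definition heis_one : heis := (0, 0).
Definition heis_inv (h : heis) : heis := (- h.1, - h.2).

Fact heis_mulA : associative heis_mul.
Proof.
move=> [u a] [v b] [w c]; rewrite /heis_mul /= addrA; congr pair.
by rewrite /symp !mxE; set i := 2%:R^-1; ring.
Qed.

Fact heis_mul1 : left_id heis_one heis_mul.
Proof.
by move=> [u a]; rewrite /heis_mul /symp /= !mxE !mul0r subr0 mulr0 !add0r addr0.
Qed.

Fact heis_mulV : left_inverse heis_one heis_inv heis_mul.
Proof.
move=> [u a]; rewrite /heis_mul /heis_one /= !addNr; congr pair.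
by rewrite /symp !mxE; set i := 2%:R^-1; ring.
Qed.

HB.instance Definition _ := Finite.on heis.
HB.instance Definition _ :=
  Finite_isGroup.Build heis heis_mulA heis_mul1 heis_mulV.

Definition SL2 : {set {'GL_2['F_p]}} :=
  [set g : {'GL_2['F_p]} | \det (GLval g) == 1].

Fact SL2_group_set : group_set SL2.
Proof.
apply/group_setP; split=> [|g h]; first by rewrite inE GL_1E det1.
by rewrite !inE GL_MxE det_mulmx => /eqP-> /eqP->; rewrite mulr1.
Qed.
Canonical SL2_group := Group SL2_group_set.

Definition SL2_act (g : {'GL_2['F_p]}) (h : heis) : heis :=
  ((GLval g : 'M['F_p]_2) *m h.1, h.2).

Definition diag_torus : {set {'GL_2['F_p]}} :=
  [set g : {'GL_2['F_p]} | [exists a : 'F_p, (a != 0) &&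
     ((GLval g : 'M['F_p]_2) ==
        diag_mx (\row_(i < 2) (if i == 0 then a else a^-1)))]].

Definition split_torus (T : {group {'GL_2['F_p]}}) : Prop :=
  exists2 g, g \in SL2 & T :=: (diag_torus :^ g)%g.

Definition cayley (g : 'M['F_p]_2) : 'M['F_p]_2 :=
  (g + 1%:M) *m invmx (g - 1%:M).

End Heisenberg.

Section Oscillator.
Variables (R : realType) (p : nat).
Local Notation C := R[i].
Local Notation H := 'cV[C]_(dimF p).

Definition expi (a : R) : C := Complex (cos a) (sin a).

Definition psi (z : 'F_p) : C := expi (2%:R * pi * (z : nat)%:R / p%:R).

(* The operator f |-> (x |-> psi (z + t w / 2 + w x) f (x + t)) attached to
   h = ((t, w), z); heis_repP and heis_rep_uniq below show that it is the
   representation determined by its values on the three standard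
   one-parameter subgroups. *)
Definition heis_rep (h : heis p) : 'M[C]_(dimF p) :=
  let t := h.1 0 0 in let w := h.1 1 0 in
  \matrix_(x, y) ((y == x + t :> 'F_p)%:R
                  * psi (h.2 + 2%:R^-1 * (t * w) + w * (x : 'F_p))).

(* The quadratic character of 'F_p, extended by 0. *)
Definition legendre (a : 'F_p) : C :=
  if a == 0 then 0 else if [exists b : 'F_p, b ^+ 2 == a] then 1 else -1.

(* For p <> 3 the first clause alone characterizes rho; for p = 3 the trace
   formula singles out one of the three solutions. *)
Definition weil_rep (rho : mx_representation C (SL2_group p) (dimF p)) : Prop :=
  (forall (g : {'GL_2['F_p]}) (h : heis p), g \in SL2 p ->
     rho g *m heis_rep h *m invmx (rho g) = heis_rep (SL2_act g h)) /\
  (p = 3%N -> forall g : {'GL_2['F_p]}, g \in SL2 p ->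
     (GLval g : 'M['F_p]_2) - 1%:M \in unitmx ->
     \tr (rho g) = legendre (- \det (cayley (GLval g) + 1%:M))).

Definition hdot (f g : H) : C := \sum_(x : 'F_p) f x 0 * conjc (g x 0).

Section Torus.
Variable T : {group {'GL_2['F_p]}}.

Definition torus_char (chi : {ffun [subg T] -> C}) : Prop :=
  chi 1%g = 1 /\ {morph chi : g h / (g * h)%g >-> g * h}.

Variable rho : {'GL_2['F_p]} -> 'M[C]_(dimF p).

Definition eigen (chi : {ffun [subg T] -> C}) : set H :=
  [set phi | forall g : [subg T], rho (sgval g) *m phi = chi g *: phi]%classic.

Definition spectrum : set {ffun [subg T] -> C} :=
  [set chi | torus_char chi /\ eigen chi <> [set 0]]%classic.

Definition unit_eigenvectors (phi : {ffun [subg T] -> C} -> H) : Prop :=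
  forall chi, spectrum chi -> eigen chi (phi chi) /\ hdot (phi chi) (phi chi) = 1.

End Torus.

Definition osc_transform (X : Type) (phi : X -> H) (f : H) (chi : X) : C :=
  hdot f (phi chi).

End Oscillator.

(* Straight-line programs: each step appends one value to the sequence of
   values computed so far, indices referring to positions in that sequence. *)
Section StraightLine.
Variable K : pzRingType.

Inductive slp_step :=
  | SlpAdd of nat & nat
  | SlpScale of K & nat.

Definition slp_eval (v : seq K) (s : slp_step) : K :=
  match s with
  | SlpAdd i j => v`_i + v`_j
  | SlpScale a i => a * v`_i
  end.

Definition slp_run (P : seq slp_step) (v : seq K) : seq K :=
  foldl (fun v s => rcons v (slp_eval v s)) v P.

Definition slp_refs_below (m : nat) (s : slp_step) : bool :=
  match s with
  | SlpAdd i j => (i < m)%N && (j < m)%N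
  | SlpScale _ i => (i < m)%N
  end.

(* Every step of P refers only to one of the m inputs or to an earlier step. *)
Fixpoint slp_wf (m : nat) (P : seq slp_step) : bool :=
  if P is s :: P' then slp_refs_below m s && slp_wf m.+1 P' else true.

(* P, started from the entries of f, produces the value F f y in some register
   (depending on y but not on f), for every y in D. *)
Definition slp_computes (n : nat) (Y : Type) (D : set Y)
    (F : 'cV[K]_n -> Y -> K) (P : seq slp_step) : Prop :=
  slp_wf n P /\
  forall y, D y -> exists2 k, (k < n + size P)%N &
    forall f : 'cV[K]_n,
      (slp_run P [seq f x 0 | x <- enum 'I_n])`_k = F f y.

End StraightLine.

Section HeisRepFacts.
Variables (R : realType) (p : nat).
Local Notation C := R[i].
Hypotheses (p_pr : prime p) (p_odd : odd p).

Lemma heis_repE (h : heis p) (f : 'cV[C]_(dimF p)) (x : 'F_p) :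
  (heis_rep R h *m f) x 0 =
  psi R (h.2 + 2%:R^-1 * (h.1 0 0 * h.1 1 0) + h.1 1 0 * x) * f (x + h.1 0 0) 0.
Proof.
rewrite !mxE (bigD1 (x + h.1 0 0 : 'F_p)) //= !mxE eqxx mul1r big1 ?addr0 //.
by move=> y /negPf ny; rewrite !mxE ny !mul0r.
Qed.

Lemma expiD (a b : R) : expi (a + b) = expi a * expi b.
Proof.
rewrite /expi cosD sinD; apply/eqP; rewrite eq_complex /= eqxx /=.
by rewrite addrC [_ * sin b]mulrC.
Qed.

Lemma expi_period (n : nat) : expi (2%:R * pi * n%:R : R) = 1.
Proof.
elim: n => [|n IH]; first by rewrite mulr0 /expi cos0 sin0.
by rewrite -[n.+1]addn1 natrD mulrDr expiD IH mulr1 mul1r /expi mulr_natl cos2pi sin2pi.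
Qed.

Lemma psi_natE (n : nat) :
  psi R (n%:R : 'F_p) = expi (2%:R * pi * n%:R / p%:R).
Proof.
have p0 : p%:R != 0 :> R by rewrite pnatr_eq0 -lt0n prime_gt0.
rewrite /psi val_Fp_nat //.
have -> : 2%:R * pi * n%:R / p%:R =
    2%:R * pi * (n %/ p)%:R + 2%:R * pi * (n %% p)%:R / p%:R :> R.
  by rewrite {1}(divn_eq n p) natrD natrM; field.
by rewrite expiD expi_period mul1r.
Qed.

Lemma psiD (a b : 'F_p) : psi R (a + b) = psi R a * psi R b.
Proof.
rewrite -[a]natr_Zp -[b]natr_Zp -natrD !psi_natE -expiD; congr expi.
by rewrite natrD; ring.
Qed.

Lemma psi0 : psi R (0 : 'F_p) = 1.
Proof. by rewrite /psi mulr0 mul0r /expi cos0 sin0. Qed.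

Lemma two_neq0 : 2%:R != 0 :> 'F_p.
Proof.
rewrite -(dvdn_pcharf (pchar_Fp p_pr)) dvdn_prime2 //.
by apply/eqP => p2; move: p_odd; rewrite p2.
Qed.

Lemma operator_ext (A B : 'M[C]_(dimF p)) :
  (forall (f : 'cV_(dimF p)) (x : 'F_p), (A *m f) x 0 = (B *m f) x 0) -> A = B.
Proof.
move=> AB; apply/matrixP=> x y.
by have := AB (delta_mx y 0) x; rewrite -!colE !mxE.
Qed.

Lemma heis_repP :
  [/\ mx_repr [set: heis p] (@heis_rep R p),
      forall (t : 'F_p) (f : 'cV_(dimF p)) (x : 'F_p),
        (heis_rep R (vec2 t 0, 0) *m f) x 0 = f (x + t) 0,
      forall (w : 'F_p) (f : 'cV_(dimF p)) (x : 'F_p),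
        (heis_rep R (vec2 0 w, 0) *m f) x 0 = psi R (w * x) * f x 0
    & forall (z : 'F_p) (f : 'cV_(dimF p)),
        heis_rep R (0, z) *m f = psi R z *: f].
Proof.
split=> [|t f x|w f x|z f].
- split=> [|g h _ _]; apply: operator_ext => f x.
    by rewrite mul1mx heis_repE /= !mxE !mul0r mulr0 !addr0 psi0 mul1r.
  rewrite -mulmxA !heis_repE /= !mxE mulrA -psiD; congr (psi _ _ * f _ _).
    have e : 2%:R^-1 * 2%:R = 1 :> 'F_p by rewrite mulVf ?two_neq0.
    rewrite /symp; move: e; set i := 2%:R^-1 => e.
    apply/subr0_eq; transitivity ((i * 2%:R - 1) * (h.1 1 0 * g.1 0 0)); first ring.
    by rewrite e subrr mul0r.
  by rewrite addrA.
- by rewrite heis_repE /= !mxE /= mulr0 mul0r mulr0 !addr0 psi0 mul1r.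
- by rewrite heis_repE /= !mxE /= mul0r mulr0 !add0r addr0.
- apply/matrixP=> x j; rewrite ord1 heis_repE !mxE /= mul0r mulr0 mul0r.
  by rewrite !addr0.
Qed.

Lemma heis_rep_uniq (rG : mx_representation C [set: heis p] (dimF p)) :
  (forall (t : 'F_p) (f : 'cV_(dimF p)) (x : 'F_p),
     (rG (vec2 t 0, 0) *m f) x 0 = f (x + t) 0) ->
  (forall (w : 'F_p) (f : 'cV_(dimF p)) (x : 'F_p),
     (rG (vec2 0 w, 0) *m f) x 0 = psi R (w * x) * f x 0) ->
  (forall (z : 'F_p) (f : 'cV_(dimF p)), rG (0, z) *m f = psi R z *: f) ->
  forall h, rG h = heis_rep R h.
Proof.
move=> pit piw piz h; apply: operator_ext => f x; rewrite heis_repE.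
case: h => v z /=; set t := v 0 0; set w := v 1 0.
have -> : (v, z) = (((0, z - 2%:R^-1 * (t * w)) : heis p)
    * (((vec2 t 0, 0) : heis p) * ((vec2 0 w, 0) : heis p)))%g.
  rewrite /mulg /= /heis_mul /=; congr pair.
    apply/colP=> i; rewrite !mxE add0r; case: eqP => [->|/eqP i0].
      by rewrite addr0.
    by rewrite add0r /w; congr (v _ 0); apply/val_inj; case: i i0 => [[|[|]]].
  by rewrite /symp !mxE /= !mul0r !subr0 !mulr0 !add0r addr0 subrK.
rewrite !repr_mxM ?inE // -!mulmxA piz mxE pit piw mulrA -psiD.
congr (psi _ _ * _).
have e : 2%:R^-1 * 2%:R = 1 :> 'F_p by rewrite mulVf ?two_neq0.
move: e; set i := 2%:R^-1 => e.
apply/subr0_eq; transitivity ((1 - i * 2%:R) * (w * t)); first ring.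
by rewrite e subrr mul0r.
Qed.

End HeisRepFacts.

(* Main.v *)
(* Write T = A^g with A the diagonal torus; multiplying g by the Weyl element if
   necessary, its upper right entry b is nonzero.  The operator W with kernel
   psi ((2 x y - d x^2 - a y^2) / 2b) intertwines pi and pi o g, so by Schur's
   lemma W conjugates rho t, for t in T, to a scalar multiple of a dilation
   f |-> f (a^-1 x).  Hence every character in the spectrum has an eigenvector
   W^* f with f a multiplicative character extended by 0, and the transform is
   W followed by a discrete Fourier transform on the cyclic group F_p^*.
   Completing squares (2 x y = (x + y)^2 - x^2 - y^2 in W, Bluestein's binomial
   version of it for the Fourier transform of length p - 1) turns both into a
   Hankel matrix between two diagonal ones.  An n x n Hankel matrix costs
   O(n log n): up to padding and reversal it is the sum of a circulant and a
   skew-circulant matrix of size 2^k, i.e. multiplications by a fixed polynomial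
   modulo X^(2^k) - 1 and X^(2^k) + 1, which Chinese remaindering splits
   recursively. *)

Require Import Defs.
From HB Require Import structures.
From mathcomp Require Import all_boot all_order all_algebra all_fingroup.
From mathcomp Require Import mxrepresentation.
From mathcomp Require Import separable cyclotomic finfield cyclic.
From mathcomp Require Import complex ring zify.
From mathcomp Require Import all_classical all_reals all_analysis.
Import Order.TTheory GRing.Theory Num.Theory.
Set Implicit Arguments.
Unset Strict Implicit.
Unset Printing Implicit Defensive.
Local Open Scope ring_scope.

(** * Straight-line cost of a matrix *)

Section Cost.
Variable K : pzRingType.
Implicit Types (P Q : seq (slp_step K)) (v : seq K).

Lemma slp_run_cat P Q v : slp_run (P ++ Q) v = slp_run Q (slp_run P v).
Proof. by rewrite /slp_run foldl_cat. Qed.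

Lemma size_slp_run P v : size (slp_run P v) = (size v + size P)%N.
Proof.
elim: P v => [|s P IH] v /=; first by rewrite addn0.
by rewrite IH size_rcons addnS.
Qed.

Lemma nth_slp_run P v j : (j < size v)%N -> (slp_run P v)`_j = v`_j.
Proof.
elim: P v => [|s P IH] v //= lt_jv.
by rewrite IH ?nth_rcons ?lt_jv // size_rcons ltnW.
Qed.

Lemma slp_wf_cat m P Q : slp_wf m (P ++ Q) = slp_wf m P && slp_wf (m + size P) Q.
Proof.
elim: P m => [|s P IH] m /=; first by rewrite addn0.
by rewrite IH addnS addSn andbA.
Qed.

Lemma slp_refs_belowW m n (s : slp_step K) :
  (m <= n)%N -> slp_refs_below m s -> slp_refs_below n s.
Proof.
move=> le_mn; case: s => [i j /andP[lt_im lt_jm]|a i] /=.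
  by rewrite !(leq_trans _ le_mn).
by move=> /leq_trans->.
Qed.

Lemma slp_wf_parallel m P : all (slp_refs_below m) P -> slp_wf m P.
Proof.
elim: P m => // s P IH m /= /andP[ms mP].
rewrite ms IH //; apply: sub_all mP => x; exact: slp_refs_belowW.
Qed.

Lemma slp_eval_prefix P v s :
  slp_refs_below (size v) s -> slp_eval (slp_run P v) s = slp_eval v s.
Proof.
by case: s => [i j /andP[? ?]|a i ?] /=; rewrite !nth_slp_run.
Qed.

(** Steps that read only registers of [v] do not see one another, so their order is immaterial. *)
Lemma nth_slp_run_parallel s0 P v i : all (slp_refs_below (size v)) P ->
  (i < size P)%N -> (slp_run P v)`_(size v + i) = slp_eval v (nth s0 P i).
Proof.
move=> vP lt_iP; rewrite -{1}(cat_take_drop i P) slp_run_cat (drop_nth s0) //=.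
have sz : size (slp_run (take i P) v) = (size v + i)%N.
  by rewrite size_slp_run size_take lt_iP.
rewrite nth_slp_run ?size_rcons ?sz // nth_rcons sz ltnn eqxx.
by rewrite slp_eval_prefix // (all_nthP s0 vP).
Qed.

(* The quantification over the length L of the state and over the locations r
   of the input is what makes these costs compose. *)
Definition slp_cost m k (M : 'M[K]_(k, m)) (s : nat) : Prop :=
  forall (L : nat) (r : 'I_m -> nat), (forall j, r j < L)%N ->
  exists P (r' : 'I_k -> nat),
    [/\ (size P <= s)%N, slp_wf L P, forall i, (r' i < L + size P)%N
      & forall v, size v = L -> forall i,
          (slp_run P v)`_(r' i) = \sum_j M i j * v`_(r j)].

Lemma slp_costW m k (M : 'M[K]_(k, m)) s t :
  slp_cost M s -> (s <= t)%N -> slp_cost M t.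
Proof.
move=> Ms le_st L r rL; have [P [r' [sP wP r'P PE]]] := Ms L r rL.
by exists P, r'; split=> //; apply: leq_trans le_st.
Qed.

(** Outputs may be located in input registers, so selecting or repeating entries takes no step. *)
Lemma slp_cost_select m k (s : 'I_k -> 'I_m) : slp_cost (rowsub s 1%:M) 0.
Proof.
move=> L r rL; exists [::], (r \o s); split=> //= [i|v _ i]; first by rewrite addn0.
rewrite (bigD1 (s i)) //= !mxE eqxx mul1r big1 ?addr0 // => j /negPf nj.
by rewrite !mxE eq_sym nj mul0r.
Qed.

(** The program of [B] runs first; its output locations are the input locations for the program of
    [A]. *)
Lemma slp_cost_mul m n k (A : 'M[K]_(k, n)) (B : 'M[K]_(n, m)) s t :
  slp_cost A s -> slp_cost B t -> slp_cost (A *m B) (s + t).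
Proof.
move=> As Bt L r rL; have [P [r1 [sP wP r1P PE]]] := Bt L r rL.
have [Q [r2 [sQ wQ r2Q QE]]] := As _ r1 r1P.
exists (P ++ Q), r2; split.
- by rewrite size_cat addnC leq_add.
- by rewrite slp_wf_cat wP.
- by move=> i; rewrite size_cat addnA.
move=> v sv i; rewrite slp_run_cat QE; last by rewrite size_slp_run sv.
under eq_bigr do rewrite PE // mulr_sumr.
rewrite exchange_big /=; apply: eq_bigr => j _.
by rewrite mxE mulr_suml; apply: eq_bigr => l _; rewrite mulrA.
Qed.

Lemma slp_cost_rowsub m k l (f : 'I_l -> 'I_k) (A : 'M[K]_(k, m)) s :
  slp_cost A s -> slp_cost (rowsub f A) s.
Proof.
by move=> As; rewrite -[A]mul1mx -mul_rowsub_mx -[s]add0n;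
  exact: slp_cost_mul (slp_cost_select f) As.
Qed.

Lemma slp_cost_col_mx m k l (A : 'M[K]_(k, m)) (B : 'M[K]_(l, m)) s t :
  slp_cost A s -> slp_cost B t -> slp_cost (col_mx A B) (s + t).
Proof.
move=> As Bt L r rL; have [P [r1 [sP wP r1P PE]]] := As L r rL.
have rLP j : (r j < L + size P)%N by rewrite ltn_addr.
have [Q [r2 [sQ wQ r2Q QE]]] := Bt _ r rLP.
exists (P ++ Q), (fun i => match fintype.split i with inl j => r1 j | inr j => r2 j end).
split.
- by rewrite size_cat leq_add.
- by rewrite slp_wf_cat wP.
- move=> i; rewrite size_cat addnA; case: splitP => j _ //.
  by rewrite ltn_addr.
move=> v sv i; rewrite slp_run_cat.
have sP' : size (slp_run P v) = (L + size P)%N by rewrite size_slp_run sv.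
under eq_bigr do rewrite mxE.
case: fintype.splitP => j _; first by rewrite nth_slp_run ?sP' ?PE.
by rewrite QE //; apply: eq_bigr => x _; rewrite nth_slp_run // sv.
Qed.

Lemma slp_cost_parallel m k (M : 'M[K]_(k, m)) :
  (forall (L : nat) (r : 'I_m -> nat), (forall j, r j < L)%N -> forall i,
     exists2 s : slp_step K, slp_refs_below L s
       & forall v, size v = L -> slp_eval v s = \sum_j M i j * v`_(r j)) ->
  slp_cost M k.
Proof.
move=> step L r rL; have {}step i := cid2 (step L r rL i).
pose g i := s2val (step i).
exists [seq g i | i <- enum 'I_k], (fun i => L + i)%N.
have gP : all (slp_refs_below L) [seq g i | i <- enum 'I_k].
  by rewrite all_map; apply/allP => i _ /=; rewrite /g; case: (step i).
have sg : size [seq g i | i <- enum 'I_k] = k by rewrite size_map size_enum_ord.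
split; rewrite ?sg ?slp_wf_parallel //.
  by move=> i; rewrite ltn_add2l.
move=> v sv i.
rewrite -[in X in (X + _)%N]sv (nth_slp_run_parallel (SlpScale 0 0)) ?sv ?sg //.
rewrite (nth_map i) ?size_enum_ord // nth_ord_enum /g.
by case: (step i) => s /= _ ->.
Qed.

Lemma slp_cost_diag m (d : 'rV[K]_m) : slp_cost (diag_mx d) m.
Proof.
apply: slp_cost_parallel => L r rL i; exists (SlpScale (d 0 i) (r i)) => //= v _.
rewrite (bigD1 i) //= mxE eqxx mulr1n big1 ?addr0 // => j /negPf nj.
by rewrite mxE eq_sym nj mulr0n mul0r.
Qed.

(** After stacking [A] over [B], one addition per row combines the two halves. *)
Lemma slp_cost_add m k (A B : 'M[K]_(k, m)) s t :
  slp_cost A s -> slp_cost B t -> slp_cost (A + B) (k + (s + t)).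
Proof.
move=> As Bt; have -> : A + B = row_mx 1%:M 1%:M *m col_mx A B.
  by rewrite mul_row_col !mul1mx.
apply: slp_cost_mul (slp_cost_col_mx As Bt).
apply: slp_cost_parallel => L r rL i.
exists (SlpAdd K (r (lshift k i)) (r (rshift k i))) => [|v _] /=; first by rewrite !rL.
rewrite big_split_ord /=; congr (_ + _); rewrite (bigD1 i) //=.
  rewrite row_mxEl mxE eqxx mul1r big1 ?addr0 // => j /negPf nj.
  by rewrite row_mxEl mxE eq_sym nj mul0r.
rewrite row_mxEr mxE eqxx mul1r big1 ?addr0 // => j /negPf nj.
by rewrite row_mxEr mxE eq_sym nj mul0r.
Qed.

Lemma slp_cost_scale m k a (A : 'M[K]_(k, m)) s :
  slp_cost A s -> slp_cost (a *: A) (k + s).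
Proof.
move=> As; rewrite -mul_scalar_mx -diag_const_mx.
exact: slp_cost_mul (slp_cost_diag _) As.
Qed.

Lemma scalar_mx_col m n :
  (1%:M : 'M[K]_(m + n)) = col_mx (row_mx 1%:M 0) (row_mx 0 1%:M).
Proof. by rewrite -block_mxEv -scalar_mx_block. Qed.

Lemma slp_cost_row_mxl m n k (A : 'M[K]_(k, m)) s :
  slp_cost A s -> slp_cost (row_mx A (0 : 'M[K]_(k, n))) s.
Proof.
move=> As; have -> : row_mx A 0 = A *m usubmx (1%:M : 'M[K]_(m + n)).
  by rewrite scalar_mx_col col_mxKu mul_mx_row mulmx1 mulmx0.
by rewrite usubmxEsub -[s]addn0; exact: slp_cost_mul As (slp_cost_select _).
Qed.

Lemma slp_cost_row_mxr m n k (A : 'M[K]_(k, n)) s :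
  slp_cost A s -> slp_cost (row_mx (0 : 'M[K]_(k, m)) A) s.
Proof.
move=> As; have -> : row_mx 0 A = A *m dsubmx (1%:M : 'M[K]_(m + n)).
  by rewrite scalar_mx_col col_mxKd mul_mx_row mulmx1 mulmx0.
by rewrite dsubmxEsub -[s]addn0; exact: slp_cost_mul As (slp_cost_select _).
Qed.

Lemma slp_cost_row_mx m n k (A : 'M[K]_(k, m)) (B : 'M[K]_(k, n)) s t :
  slp_cost A s -> slp_cost B t -> slp_cost (row_mx A B) (k + (s + t)).
Proof.
move=> As Bt; have -> : row_mx A B = row_mx A 0 + row_mx 0 B.
  by rewrite add_row_mx addr0 add0r.
apply: slp_cost_add.
  exact: slp_cost_row_mxl.
exact: slp_cost_row_mxr.
Qed.

Lemma slp_cost_block m n k l (A : 'M[K]_(k, m)) (B : 'M[K]_(k, n))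
    (C : 'M[K]_(l, m)) (D : 'M[K]_(l, n)) a b c d :
  slp_cost A a -> slp_cost B b -> slp_cost C c -> slp_cost D d ->
  slp_cost (block_mx A B C D) (k + l + (a + b + (c + d))).
Proof.
move=> Aa Bb Cc Dd; rewrite block_mxEv addnACA.
by apply: slp_cost_col_mx; apply: slp_cost_row_mx.
Qed.

Lemma slp_cost_scalar m (a : K) : slp_cost (a%:M : 'M[K]_m) m.
Proof. by rewrite -diag_const_mx; exact: slp_cost_diag. Qed.

(** No sums are formed, which saves the [k + l] additions of [slp_cost_block]. *)
Lemma slp_cost_block_diag m n k l (A : 'M[K]_(k, m)) (B : 'M[K]_(l, n)) a b :
  slp_cost A a -> slp_cost B b -> slp_cost (block_mx A 0 0 B) (a + b).
Proof.
move=> Aa Bb; rewrite block_mxEv.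
by apply: slp_cost_col_mx; [exact: slp_cost_row_mxl | exact: slp_cost_row_mxr].
Qed.

(** One multiplication by 0 creates a zero shared by all rows with [s i = None]; it has to scale an
    existing register, hence [0 < m]. *)
Lemma slp_cost_pad m k (s : 'I_k -> option 'I_m) : (0 < m)%N ->
  slp_cost (\matrix_(i, j) (s i == Some j)%:R) 1.
Proof.
move=> m_gt0 L r rL; pose j0 := Ordinal m_gt0.
exists [:: SlpScale 0 (r j0)], (fun i => if s i is Some j then r j else L).
split=> //= [|i|v sv i]; first by rewrite rL.
  by rewrite addn1 ltnS; case: (s i) => [j|] //; exact: ltnW (rL j).
case E: (s i) => [j|].
  rewrite nth_rcons sv rL (bigD1 j) //= mxE E eqxx mul1r big1 ?addr0 // => l nl.
  by rewrite mxE E -[Some j == _]/(j == l) eq_sym (negPf nl) mul0r.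
rewrite nth_rcons sv ltnn eqxx mul0r big1 // => l _.
by rewrite mxE E mul0r.
Qed.
End Cost.

(** * Circulant and Hankel matrices *)

Section Convolution.
Variable K : numClosedFieldType.
Implicit Types (mu nu : K) (b : nat -> K).

(* Multiplication by \sum_k b k X^k modulo X^n - mu, in the monomial basis. *)
Definition circ n mu b : 'M[K]_n :=
  \matrix_(i, j) if (j <= i)%N then b (i - j)%N else mu * b (n + i - j)%N.

(* Chinese remaindering X^(2n) - nu^2 = (X^n - nu) (X^n + nu). *)
Lemma circ_double n nu b : nu != 0 ->
  circ (n + n) (nu ^+ 2) b =
  block_mx 2^-1%:M 2^-1%:M (2 * nu)^-1%:M (- (2 * nu)^-1)%:M
  *m block_mx (circ n nu (fun k => b k + nu * b (n + k)%N)) 0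
              0 (circ n (- nu) (fun k => b k - nu * b (n + k)%N))
  *m block_mx 1%:M nu%:M 1%:M (- nu)%:M.
Proof.
move=> nu0; have two0 : (2 : K) != 0 by rewrite pnatr_eq0.
rewrite !mulmx_block !(mul0mx, mulmx0, addr0, add0r) !mul_scalar_mx.
rewrite !mulmx1 !mul_mx_scalar.
rewrite -[circ (n + n) _ _]submxK.
congr block_mx; apply/matrixP => i j; rewrite !mxE /=; have := ltn_ord i; have := ltn_ord j.
- case: (leqP j i) => ij lj li.
    have -> : (n + (i - j) = n + i - j)%N by lia.
    by field.
  have -> : (n + (n + i - j) = n + n + i - j)%N by lia.
  by field.
- case: (leqP (n + j) i) => nij; case: (leqP j i) => ij lj li; try lia.
    have -> : (n + n + i - (n + j) = n + (i - j))%N by lia.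
    by field.
  have -> : (n + n + i - (n + j) = n + i - j)%N by lia.
  have -> : (n + (n + i - j) = n + n + i - j)%N by lia.
  by field.
- case: (leqP j (n + i)) => nij; case: (leqP j i) => ij lj li; try lia.
    have -> : (n + (i - j) = n + i - j)%N by lia.
    by field.
  have -> : (n + (n + i - j) = n + n + i - j)%N by lia.
  by field.
rewrite leq_add2l; case: (leqP j i) => ij lj li.
  have -> : (n + i - (n + j) = i - j)%N by lia.
  have -> : (n + (i - j) = n + i - j)%N by lia.
  by field.
have -> : (n + n + (n + i) - (n + j) = n + n + i - j)%N by lia.
have -> : (n + (n + i - j) = n + n + i - j)%N by lia.
by field.
Qed.

(** Doubling as [n + n] lets the next size match that of a block matrix by conversion. *)
Fixpoint pow2 k := if k is k'.+1 then (pow2 k' + pow2 k')%N else 1%N.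

Lemma pow2E k : pow2 k = (2 ^ k)%N.
Proof. by elim: k => //= k ->; rewrite addnn -mul2n expnS. Qed.

(** One level adds two block matrices of scalars, of cost [6 * 2 ^ k] each, to two products of half
    size. The induction ranges over all nonzero [mu], since halving replaces [mu] by its two square
    roots. *)
Lemma slp_cost_circ k mu b : mu != 0 ->
  slp_cost (circ (pow2 k) mu b) ((12 * k + 1) * 2 ^ k).
Proof.
elim: k mu b => [|k IH] mu b mu0.
  have -> : circ (pow2 0) mu b = (b 0%N)%:M.
    by apply/matrixP => i j; rewrite !ord1 !mxE eqxx.
  exact: slp_cost_scalar.
rewrite -[mu]sqrtCK /= circ_double ?sqrtC_eq0 //.
set N := pow2 k; set nu := sqrtC mu.
have nu0 : nu != 0 by rewrite sqrtC_eq0.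
have blk a c d e := slp_cost_block (@slp_cost_scalar K N a)
   (@slp_cost_scalar K N c) (@slp_cost_scalar K N d) (@slp_cost_scalar K N e).
apply: slp_costW.
  apply: slp_cost_mul; last exact: blk.
  apply: slp_cost_mul; first exact: blk.
  by apply: slp_cost_block_diag; apply: IH; rewrite ?oppr_eq0.
rewrite /N pow2E expnS; nia.
Qed.

Lemma slp_cost_hankel_pow2 n k (h : nat -> K) : (0 < n)%N -> (n <= 2 ^ k)%N ->
  slp_cost (\matrix_(i < n, j < n) h (i + j)%N) ((24 * k + 5) * 2 ^ k).
Proof.
rewrite -pow2E; set N := pow2 k => n_gt0 le_nN.
(* The reversed Hankel matrix is Toeplitz, and a Toeplitz matrix is the sum of
   a circulant and a skew-circulant one. *)
pose b1 i := (h (N + i).-1 + h i.-1) / 2; pose b2 i := (h (N + i).-1 - h i.-1) / 2.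
(* Reversal sends coordinate [j] to position [N - 1 - j]; where [insub] fails, the vector is padded
   with zeros. *)
pose s (i : 'I_N) : option 'I_n := insub (N - i.+1)%N.
have -> : \matrix_(i < n, j < n) h (i + j)%N =
    rowsub (widen_ord le_nN) (circ N 1 b1 + circ N (-1) b2)
    *m \matrix_(i, j) (s i == Some j)%:R.
  apply/matrixP => i j; rewrite !mxE.
  have jN : (N - j.+1 < N)%N by have := ltn_ord j; lia.
  have sj l : (s l == Some j) = (l == Ordinal jN).
    rewrite /s -(inj_eq val_inj) /=; case: insubP => [u _ ul|nl].
      rewrite -[Some u == _]/(u == j) -(inj_eq val_inj) /= ul.
      have := ltn_ord l; have := ltn_ord j; lia.
    by rewrite -[None == _]/false; have := ltn_ord l; have := ltn_ord j; lia.
  rewrite (bigD1 (Ordinal jN)) //= big1 ?addr0 => [|l /negPf nl].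
    rewrite !mxE sj eqxx mulr1 /b1 /b2 /=.
    have := ltn_ord i; have := ltn_ord j.
    (* With [l = N - 1 - j], the entry is a sum of values of [b1] and [b2] if [l <= i] and a
       difference otherwise; both equal [h] at [N + i - l - 1 = i + j]. *)
    case: (leqP (N - j.+1) i) => le lj li.
      have -> : (N + (i - (N - j.+1))).-1 = (i + j)%N by lia.
      by field.
    have -> : (N + i - (N - j.+1)).-1 = (i + j)%N by lia.
    by field.
  by rewrite !mxE sj nl mulr0.
apply: slp_costW.
  apply: slp_cost_mul; last exact: slp_cost_pad.
  apply: slp_cost_rowsub; apply: slp_cost_add; apply: slp_cost_circ.
    exact: oner_neq0.
  by rewrite oppr_eq0 oner_neq0.
rewrite /N pow2E; have := expn_gt0 2 k; nia.
Qed.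

(** For [k > 0], [24 * k + 5 <= 29 * k], and [87 = 29 * 3]. *)
Lemma slp_cost_hankel n k (h : nat -> K) : (0 < n)%N -> (n <= 2 ^ k)%N ->
  (2 ^ k <= 3 * n)%N -> (0 < k)%N ->
  slp_cost (\matrix_(i < n, j < n) h (i + j)%N) (87 * (n * k)).
Proof.
move=> n_gt0 le_n le_k k_gt0.
apply: slp_costW (slp_cost_hankel_pow2 h n_gt0 le_n) _; nia.
Qed.
End Convolution.

(** * Intertwining operators of the Heisenberg representation *)

Section Weil.
Variables (R : realType) (p : nat).
Local Notation C := R[i].
Local Notation psi := (psi R).
Local Notation pi_ := (@heis_rep R p).
Hypotheses (p_pr : prime p) (p_odd : odd p).

(** The imaginary part [sin (2 pi / p)] is positive because [p > 2]. *)
Lemma psi1_neq1 : psi (1 : 'F_p) != 1.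
Proof.
have p2 : (2 < p)%N by case: p p_pr p_odd => [|[|[|]]].
apply/eqP => -[_]; apply/eqP; rewrite gt_eqF // sin_gt0_pi //.
rewrite modn_small ?Fp_cast ?prime_gt1 // /=.
have p0 : 0 < p%:R :> R by rewrite ltr0n prime_gt0.
rewrite mulr1 divr_gt0 ?mulr_gt0 ?pi_gt0 //= ltr_pdivrMr // mulrC ltr_pM2l ?pi_gt0 //.
by rewrite ltr_nat.
Qed.

Lemma psi_mulN (z : 'F_p) : psi z * psi (- z) = 1.
Proof. by rewrite -psiD // subrr psi0. Qed.

Lemma psi_neq0 (z : 'F_p) : psi z != 0.
Proof.
by apply/eqP => z0; have /eqP := psi_mulN z; rewrite z0 mul0r eq_sym oner_eq0.
Qed.

Lemma conjc_psi (z : 'F_p) : conjc (psi z) = psi (- z).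
Proof.
apply: (mulfI (psi_neq0 z)); rewrite psi_mulN /Defs.psi /expi /=.
set t := _ / _; apply/eqP; rewrite eq_complex /=.
by rewrite !mulrN opprK -!expr2 cos2Dsin2 [cos t * sin t]mulrC addNr !eqxx.
Qed.

(** If [c != 0], shifting [y] by [c^-1] multiplies the sum by [psi 1], which is not 1. *)
Lemma sum_psi (c : 'F_p) : \sum_(y : 'F_p) psi (c * y) = if c == 0 then p%:R else 0.
Proof.
case: eqVneq => [->|c0].
  under eq_bigr do rewrite mul0r psi0.
  by rewrite sumr_const card_Fp.
set S := \sum_y _; suff: (psi (1 : 'F_p) - 1) * S = 0.
  by move=> /eqP; rewrite mulf_eq0 subr_eq0 (negPf psi1_neq1) => /eqP.
rewrite mulrBl mul1r mulr_sumr; apply/eqP; rewrite subr_eq0; apply/eqP.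
rewrite [RHS](reindex_inj (addrI c^-1)); apply: eq_bigr => y _ /=.
by rewrite mulrDr divff // psiD.
Qed.

Lemma heis_mulmx m (h : heis p) (M : 'M[C]_(dimF p, m)) (x : 'F_p) y :
  (pi_ h *m M) x y =
  psi (h.2 + 2%:R^-1 * (h.1 0 0 * h.1 1 0) + h.1 1 0 * x) * M (x + h.1 0 0) y.
Proof.
transitivity (col y (pi_ h *m M) x 0); first by rewrite [RHS]mxE.
have <- : pi_ h *m col y M = col y (pi_ h *m M) by rewrite !colE mulmxA.
by rewrite heis_repE mxE.
Qed.

Lemma mulmx_heis m (h : heis p) (M : 'M[C]_(m, dimF p)) x (y : 'F_p) :
  (M *m pi_ h) x y =
  psi (h.2 + 2%:R^-1 * (h.1 0 0 * h.1 1 0) + h.1 1 0 * (y - h.1 0 0))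
  * M x (y - h.1 0 0).
Proof.
rewrite mxE (bigD1 (y - h.1 0 0)) //= mxE subrK eqxx mul1r mulrC big1 ?addr0 //.
move=> z /negPf nz; rewrite mxE -subr_eq eq_sym nz.
by rewrite mul0r mulr0.
Qed.

(** Commuting with translations makes the diagonal constant. Commuting with the modulation of
    frequency [(x - y)^-1], whose values at [x] and [y] differ by the factor [psi 1], kills the
    entry at [(x, y)]. *)
Lemma heis_schur (M : 'M[C]_(dimF p)) :
  (forall h, M *m pi_ h = pi_ h *m M) -> exists c, M = c%:M.
Proof.
move=> MC; exists (M 0 0); apply/matrixP => x y; rewrite mxE.
case: eqVneq => [<-|ne].
  have /matrixP/(_ (0 : 'F_p) (x : 'F_p)) := MC (vec2 (x : 'F_p) 0, 0).
  rewrite heis_mulmx mulmx_heis !mxE /= !mulr0 !mul0r !addr0 psi0 !mul1r.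
  by rewrite subrr add0r mulr1n.
rewrite mulr0n.
have /matrixP/(_ (x : 'F_p) (y : 'F_p)) := MC (vec2 0 ((x : 'F_p) - y)^-1, 0).
rewrite heis_mulmx mulmx_heis !mxE /= mul0r mulr0 !add0r subr0 addr0.
have xy0 : (x : 'F_p) - y != 0 by rewrite subr_eq0.
have -> : ((x : 'F_p) - y)^-1 * x = 1 + ((x : 'F_p) - y)^-1 * y.
  by rewrite -{2}(subrK (y : 'F_p) (x : 'F_p)) mulrDr mulVf.
rewrite psiD //; set w := psi (_ * y) => /eqP.
rewrite -subr_eq0 -mulrBl -{1}[w]mul1r -mulrBl !mulf_eq0 subr_eq0 eq_sym.
by rewrite (negPf psi1_neq1) (negPf (psi_neq0 _)) /= => /eqP.
Qed.

(** * Operators intertwining the Heisenberg representation with its twists *)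

Definition mx_act (G : 'M['F_p]_2) (h : heis p) : heis p := (G *m h.1, h.2).

Lemma mx_actM (G K : 'M['F_p]_2) h : mx_act (G *m K) h = mx_act G (mx_act K h).
Proof. by rewrite /mx_act mulmxA. Qed.

Definition intertwines (G : 'M['F_p]_2) (W : 'M[C]_(dimF p)) : Prop :=
  forall h, W *m pi_ h = pi_ (mx_act G h) *m W.

Lemma intertwinesM G K W U :
  intertwines G W -> intertwines K U -> intertwines (G *m K) (W *m U).
Proof. by move=> GW KU h; rewrite -mulmxA KU mulmxA GW mx_actM mulmxA. Qed.

Lemma intertwinesV G W :
  G \in unitmx -> W \in unitmx -> intertwines G W -> intertwines (invmx G) (invmx W).
Proof.
move=> Gu Wu GW h; apply: (can_inj (mulKmx Wu)); rewrite mulmxA mulmxV // mul1mx.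
rewrite mulmxA GW -mx_actM mulmxV // -mulmxA mulmxV // mulmx1; congr (pi_ _).
by case: h => v z; rewrite /mx_act mul1mx.
Qed.

(** The operator [invmx W *m U] commutes with the representation, so it is scalar. *)
Lemma intertwines_uniq G W U : G \in unitmx -> W \in unitmx ->
  intertwines G W -> intertwines G U -> exists c, U = c *: W.
Proof.
move=> Gu Wu GW GU; have [h|c e] := @heis_schur (invmx W *m U).
  rewrite (intertwinesM (intertwinesV Gu Wu GW) GU) mulVmx //; congr (pi_ _ *m _).
  by case: h => v z; rewrite /mx_act mul1mx.
by exists c; rewrite -[U](mulKVmx Wu) e mul_mx_scalar.
Qed.

Lemma mulmx2E (G : 'M['F_p]_2) (v : 'cV_2) i :
  (G *m v) i 0 = G i 0 * v 0 0 + G i 1 * v 1 0.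
Proof. by rewrite mxE big_ord_recl big_ord1; congr (_ + G i _ * v _ _); apply/val_inj. Qed.

Lemma det2E (G : 'M['F_p]_2) : \det G = G 0 0 * G 1 1 - G 0 1 * G 1 0.
Proof.
rewrite (expand_det_row _ 0) big_ord_recl big_ord1 /cofactor !det_mx11 !mxE /=.
rewrite expr0 expr1 mul1r mulN1r mulrN.
by congr (G _ _ * G _ _ - G _ _ * G _ _); apply/val_inj.
Qed.

(* Kernel of the metaplectic operator, up to the factor p^(-1/2), for a matrix
   with nonzero upper right entry. *)
Definition weil_kernel (G : 'M['F_p]_2) : 'M[C]_(dimF p) :=
  \matrix_(x, y) psi ((2%:R * G 0 1)^-1 *
    (2%:R * (x : 'F_p) * (y : 'F_p) - G 1 1 * (x : 'F_p) ^+ 2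
     - G 0 0 * (y : 'F_p) ^+ 2)).

(** Entries on both sides are single values of [psi]; the exponents agree once the determinant
    condition has eliminated the lower left entry. *)
Lemma weil_kernel_intertwines (G : 'M['F_p]_2) : \det G = 1 -> G 0 1 != 0 ->
  intertwines G (weil_kernel G).
Proof.
rewrite det2E => detG G01 [v z]; apply/matrixP => x y.
rewrite mulmx_heis heis_mulmx /mx_act /= !mulmx2E !mxE -!psiD //; congr (psi _).
have two0 : 2%:R != 0 :> 'F_p by exact: two_neq0.
move: detG; set a := G 0 0; set b := G 0 1; set c := G 1 0; set d := G 1 1.
set t := v 0 0; set w := v 1 0 => detG.
have -> : c = (a * d - 1) / b by rewrite -detG; field.
by field; apply/andP.
Qed.

(** The terms quadratic in [y] cancel, leaving a character sum of frequency [(x - z) / G 0 1]. *)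
Lemma weil_kernel_unitary (G : 'M['F_p]_2) : G 0 1 != 0 ->
  weil_kernel G *m map_mx (@conjc R) (weil_kernel G)^T = p%:R%:M.
Proof.
move=> G01; have two0 : 2%:R != 0 :> 'F_p by exact: two_neq0.
apply/matrixP => x z; rewrite !mxE.
pose c := (2%:R * G 0 1)^-1 * (- G 1 1 * ((x : 'F_p) ^+ 2 - (z : 'F_p) ^+ 2)).
transitivity (psi c * \sum_(y : 'F_p) psi (((x : 'F_p) - z) / G 0 1 * y)).
  rewrite mulr_sumr; apply: eq_bigr => y _.
  rewrite !mxE conjc_psi -!psiD //; congr (psi _); rewrite /c.
  by field; apply/andP.
rewrite sum_psi mulf_eq0 invr_eq0 (negPf G01) orbF subr_eq0 /c.
case: eqVneq => [->|_]; last by rewrite mulr0 mulr0n.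
by rewrite subrr !mulr0 psi0 mul1r mulr1n.
Qed.

(** * Dilations as operators of diagonal matrices *)

Definition diag2 (a : 'F_p) : 'M['F_p]_2 :=
  diag_mx (\row_(i < 2) (if i == 0 then a else a^-1)).

Definition dilation (a : 'F_p) : 'M[C]_(dimF p) :=
  \matrix_(x, y) ((y : 'F_p) == a^-1 * (x : 'F_p))%:R.

Lemma dilation_mulmx m a (M : 'M[C]_(dimF p, m)) (x : 'F_p) y :
  (dilation a *m M) x y = M (a^-1 * x) y.
Proof.
rewrite mxE (bigD1 (a^-1 * x)) //= mxE eqxx mul1r big1 ?addr0 //.
by move=> z /negPf nz; rewrite mxE nz mul0r.
Qed.

Lemma diag2_unit (a : 'F_p) : a != 0 -> diag2 a \in unitmx.
Proof. by move=> a0; rewrite unitmxE det_diag big_ord_recl big_ord1 !mxE /= divff ?unitr1. Qed.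

Lemma dilation_unit (a : 'F_p) : a != 0 -> dilation a \in unitmx.
Proof.
move=> a0; suff /mulmx1_unit[] : dilation a *m dilation a^-1 = 1%:M by [].
apply/matrixP => x y; rewrite dilation_mulmx !mxE invrK mulrA divff // mul1r.
by rewrite eq_sym.
Qed.

Lemma dilation_intertwines (a : 'F_p) : a != 0 -> intertwines (diag2 a) (dilation a).
Proof.
move=> a0 [v z]; apply/matrixP => x y.
rewrite mulmx_heis heis_mulmx /mx_act /= !mulmx2E !mxE /=.
rewrite !mulr0n !mulr1n !mul0r addr0 add0r subr_eq [a^-1 * (x + _)]mulrDr mulKf //.
case: eqVneq => [->|_]; last by rewrite !mulr0.
rewrite addrK; congr (psi _ * _); field.
by rewrite a0 (two_neq0 p_pr p_odd).
Qed.
End Weil.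

(** * Discrete Fourier transform and split tori *)

Lemma slp_cost_dft (K : numClosedFieldType) n k (w : K) :
  w != 0 -> (0 < n)%N -> (n <= 2 ^ k)%N -> (2 ^ k <= 3 * n)%N -> (0 < k)%N ->
  slp_cost (\matrix_(l < n, j < n) w ^+ (l * j)) (89 * (n * k)).
Proof.
move=> w0 n_gt0 le_n le_k k_gt0.
pose d : 'rV[K]_n := \row_j w ^- 'C(j, 2).
(* Bluestein's chirp: l j = C(l + j, 2) - C(l, 2) - C(j, 2). *)
have -> : \matrix_(l < n, j < n) w ^+ (l * j) =
    diag_mx d *m ((\matrix_(l < n, j < n) w ^+ 'C(l + j, 2)) *m diag_mx d).
  apply/matrixP => l j; rewrite mul_diag_mx mul_mx_diag !mxE.
  have -> : 'C(l + j, 2) = ('C(l, 2) + l * j + 'C(j, 2))%N.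
    have e m : ('C(m, 2) * 2 + m = m * m)%N.
      by elim: m => // m IH; rewrite binS bin1; nia.
    by have := e l; have := e j; have := e (l + j)%N; nia.
  by rewrite !exprD mulfK ?mulKf ?expf_neq0.
apply: slp_costW.
  apply: slp_cost_mul; first exact: slp_cost_diag.
  apply: slp_cost_mul; last exact: slp_cost_diag.
  exact: (slp_cost_hankel (fun m => w ^+ 'C(m, 2)) n_gt0 le_n le_k k_gt0).
nia.
Qed.

(** In characteristic 0 the split polynomial [X^n - 1] is separable, so it has [n] distinct
    roots. *)
Lemma prim_root_exists (K : numClosedFieldType) n :
  (0 < n)%N -> exists z : K, n.-primitive_root z.
Proof.
pose p : {poly K} := 'X^n - 1; have [rs Dp] := closed_field_poly_normal p.
move=> n_gt0; rewrite lead_coefDl ?size_polyXn ?size_polyN ?size_poly1 // in Dp.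
rewrite lead_coefXn scale1r in Dp.
have rn1 : all n.-unity_root rs by apply/allP => z; rewrite -root_prod_XsubC -Dp.
have sz_rs : (n < (size rs).+1)%N.
  by rewrite -(size_prod_XsubC rs id) -Dp size_XnsubC.
suff /(has_prim_root n_gt0 rn1) : uniq rs.
  by move=> /(_ sz_rs) /hasP[z _ pz]; exists z.
rewrite -separable_prod_XsubC -Dp.
by rewrite separable_Xn_sub_1 // pnatr_eq0 -lt0n.
Qed.

(** By Fermat the [p - 1] nonzero elements are all roots of unity of order dividing [p - 1]. *)
Lemma Fp_prim_root p : prime p -> exists g : 'F_p, (p.-1).-primitive_root g.
Proof.
move=> p_pr; pose rs := [seq x <- enum 'F_p | x != 0].
have p1 : (0 < p.-1)%N by have := prime_gt1 p_pr; lia.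
have /hasP[g _ gP] : has (p.-1).-primitive_root rs.
  apply: has_prim_root => //.
  - apply/allP => x; rewrite mem_filter => /andP[x0 _]; rewrite unity_rootE.
    rewrite -(inj_eq (mulfI x0)) -exprS prednK ?prime_gt0 // mulr1.
    by rewrite -[X in _ == X]expf_card card_Fp.
  - by rewrite filter_uniq // enum_uniq.
  have -> : size rs = #|predC1 (0 : 'F_p)|.
    by rewrite cardE /rs enumT; congr size; apply: eq_filter => x.
  by rewrite cardC1 card_Fp.
by exists g.
Qed.

(** * Normal form of a split torus *)

Section Torus.
Variable p : nat.

(** Supplies a conjugating matrix for which [weil_kernel] is available. Stating the conjugation
    without inverses suits the composition of intertwiners. *)
Lemma split_torus_conj (T : {group {'GL_2['F_p]}}) : split_torus T ->
  exists G : 'M['F_p]_2, [/\ \det G = 1, G 0 1 != 0,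
    forall t, t \in T -> t \in SL2 p /\
      exists2 a, a != 0 & G *m (GLval t : 'M['F_p]_2) = diag2 a *m G
  & forall a, a != 0 -> exists2 t, t \in T & G *m (GLval t : 'M['F_p]_2) = diag2 a *m G].
Proof.
case=> g gS TE; pose g0 : 'M['F_p]_2 := GLval g.
have g1 : \det g0 = 1 by move: gS; rewrite inE => /eqP.
have TP t : t \in T -> t \in SL2 p /\
    exists2 a, a != 0 & g0 *m (GLval t : 'M['F_p]_2) = diag2 a *m g0.
  rewrite TE => /imsetP[d dD ->{t}]; move: dD; rewrite inE => /existsP[a /andP[a0 /eqP dE]].
  split.
    rewrite conjgE !groupM ?groupV // inE dE det_diag big_ord_recl big_ord1 !mxE /=.
    by rewrite divff.
  exists a => //; transitivity ((GLval d : 'M['F_p]_2) *m g0); last by rewrite dE.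
  exact: esym (congr1 (@GLval 2 'F_p) (conjgC d g)).
have PT a : a != 0 -> exists2 t, t \in T & g0 *m (GLval t : 'M['F_p]_2) = diag2 a *m g0.
  move=> a0; pose d : {'GL_2['F_p]} := FinRing.Unit (diag2_unit a0).
  exists (d ^ g)%g.
    by rewrite TE memJ_conjg inE; apply/existsP; exists a; rewrite a0 eqxx.
  exact: esym (congr1 (@GLval 2 'F_p) (conjgC d g)).
have [g01|g01] := eqVneq (g0 0 1) 0; last by exists g0.
(* Replacing g by w g, with w the Weyl element, does not change diag_torus :^ g. *)
pose w : 'M['F_p]_2 := \matrix_(i, j) (if i == 0 then (j == 1)%:R else - (j == 0)%:R).
have wg i j : (w *m g0) i j = if i == 0 then g0 1 j else - g0 0 j.
  rewrite mxE big_ord_recl big_ord1 !mxE /=; case: (i == 0) => /=.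
    by rewrite mul0r mul1r add0r; congr (g0 _ _); apply/val_inj.
  by rewrite mulN1r oppr0 mul0r addr0.
(* Conjugation by [w] exchanges the diagonal entries, so [a] becomes [a^-1]. *)
have wd a : w *m diag2 a = diag2 a^-1 *m w.
  apply/matrixP => i j; rewrite mul_diag_mx mul_mx_diag !mxE invrK.
  by case: i => [[|[|[]]] //= ?]; case: j => [[|[|[]]] //= ?]; rewrite ?mulr1 ?mul1r ?mulN1r ?mulrN1 ?mulr0 ?mul0r ?oppr0 ?mul0r ?mulr0.
have swap a t : g0 *m t = diag2 a *m g0 -> (w *m g0) *m t = diag2 a^-1 *m (w *m g0).
  by move=> e; rewrite -mulmxA e !mulmxA wd.
exists (w *m g0); split.
- rewrite det2E !wg /=; move: g1; rewrite det2E g01 => <-; ring.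
- rewrite wg /=; apply/eqP => g11; move: g1; rewrite det2E g01 g11 mulr0 mul0r subrr.
  by move/eqP; rewrite eq_sym oner_eq0.
- move=> t /TP[tS [a a0 e]]; split=> //; exists a^-1; rewrite ?invr_eq0 //; exact: swap.
move=> a a0; have [|t tT e] := PT a^-1; first by rewrite invr_eq0.
by exists t => //; rewrite (swap _ _ e) invrK.
Qed.
End Torus.

(** * Cost of the kernel, and the torus action seen through it *)

Section Transform.
Variables (R : realType) (p : nat).
Local Notation C := R[i].
Local Notation adj M := (map_mx (@conjc R) M^T).
Hypotheses (p_pr : prime p) (p_odd : odd p).

(** Completing the square leaves [e * (x + y) ^+ 2] minus a term in [x] and a term in [y]. Since
    [psi] only sees residues, [h] can be indexed by the unreduced sum of [x] and [y]. *)
Lemma slp_cost_weil_kernel k (G : 'M['F_p]_2) :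
  (p <= 2 ^ k)%N -> (2 ^ k <= 3 * p)%N -> (0 < k)%N ->
  slp_cost (weil_kernel R G) (89 * (p * k)).
Proof.
move=> le_p le_k k_gt0; pose e := (2%:R * G 0 1)^-1.
pose d (s : 'F_p) : 'rV[C]_(dimF p) := \row_x psi R (- e * (1 + s) * (x : 'F_p) ^+ 2).
pose h m := psi R (e * (m%:R : 'F_p) ^+ 2).
have -> : weil_kernel R G = diag_mx (d (G 1 1)) *m
    ((\matrix_(x < dimF p, y < dimF p) h (x + y)%N) *m diag_mx (d (G 0 0))).
  apply/matrixP => x y; rewrite mul_diag_mx mul_mx_diag !mxE /h natrD.
  rewrite !natr_Zp -!psiD //; congr (psi _ _); rewrite -/e; ring.
have pE : dimF p = p by rewrite Fp_cast.
apply: slp_costW.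
  apply: slp_cost_mul; first exact: slp_cost_diag.
  apply: slp_cost_mul; last exact: slp_cost_diag.
  by apply: (slp_cost_hankel h _ _ _ k_gt0); rewrite ?pE ?prime_gt0.
rewrite pE; nia.
Qed.

Lemma weil_rep_intertwines (rho : mx_representation C (SL2_group p) (dimF p)) g :
  weil_rep rho -> g \in SL2 p -> intertwines (GLval g) (rho g).
Proof.
case=> rhoP _ gS h; rewrite -[mx_act _ h]/(SL2_act g h) -rhoP //.
by rewrite -[RHS]mulmxA mulVmx ?mulmx1 ?repr_mx_unit.
Qed.

Variables (G : 'M['F_p]_2).
Hypotheses (detG : \det G = 1) (G01 : G 0 1 != 0).
Local Notation W := (weil_kernel R G).

Lemma weil_kernel_unit : W \in unitmx.
Proof.
have /mulmx1_unit[] // : W *m ((p%:R)^-1 *: adj W) = 1%:M.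
rewrite -scalemxAr weil_kernel_unitary // scale_scalar_mx mulVf //.
by rewrite pnatr_eq0 -lt0n prime_gt0.
Qed.

(** Both products intertwine the same matrix [G t = diag2 a G], so they are proportional. *)
Lemma weil_rep_torus (rho : mx_representation C (SL2_group p) (dimF p)) t a :
  weil_rep rho -> t \in SL2 p -> a != 0 ->
  G *m (GLval t : 'M['F_p]_2) = diag2 a *m G ->
  exists2 c, c != 0 & W *m rho t = c *: (dilation R a *m W).
Proof.
move=> wr tS a0 GtE; have Wu := weil_kernel_unit.
have Gu : G \in unitmx by rewrite unitmxE detG unitr1.
have Wi := weil_kernel_intertwines R p_pr p_odd detG G01.
have i1 := intertwinesM (dilation_intertwines R p_pr p_odd a0) Wi.
have i2 := intertwinesM Wi (weil_rep_intertwines wr tS).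
rewrite GtE in i2.
have [||c cE] := intertwines_uniq p_pr p_odd _ _ i1 i2.
- by rewrite unitmx_mul diag2_unit.
- by rewrite unitmx_mul dilation_unit.
exists c => //; apply/eqP => c0; move: cE; rewrite c0 scale0r => /eqP.
have : W *m rho t \in unitmx by rewrite unitmx_mul Wu repr_mx_unit.
by move=> + /eqP E; rewrite E unitmxE det0 unitr0.
Qed.
End Transform.

(** * Eigenvectors of a split torus *)

Section Eigenvectors.
Variables (R : realType) (p : nat).
Local Notation C := R[i].
Local Notation adj M := (map_mx (@conjc R) M^T).
Hypotheses (p_pr : prime p) (p_odd : odd p).
Local Notation n := p.-1.
Variables (gam : 'F_p) (eta : C).
Hypotheses (gamP : n.-primitive_root gam) (etaP : n.-primitive_root eta).

Lemma Fp_unit_pow (x : 'F_p) : x != 0 -> exists i : 'I_n, x = gam ^+ i.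
Proof.
move=> x0; have [i ->] : {i : 'I_n | x = gam ^+ i}; last by exists i.
apply: (prim_rootP gamP); apply: (mulfI x0).
by rewrite -exprS prednK ?prime_gt0 // mulr1 -[RHS]expf_card card_Fp.
Qed.

Lemma prim_root_mul_conjc : eta * conjc eta = 1.
Proof.
have n0 := prim_order_gt0 etaP.
have : `|eta| ^+ n == 1 by rewrite -normrX (prim_expr_order etaP) normr1.
rewrite pexpr_eq1 // => /eqP e1.
by have := normCK eta; rewrite e1 expr1n => ->.
Qed.

(* Row l is the complex conjugate of the multiplicative character of 'F_p that
   maps gam to eta ^ l, extended by 0. *)
Definition mult_chars : 'M[C]_(n, dimF p) :=
  (\matrix_(l < n, j < n) conjc eta ^+ (l * j))
  *m rowsub (fun j : 'I_n => (gam ^+ j : 'F_p)) 1%:M.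

Lemma adj_mulmx m k l (A : 'M[C]_(m, k)) (B : 'M[C]_(k, l)) :
  adj (A *m B) = adj B *m adj A.
Proof. by rewrite trmx_mul map_mxM. Qed.

Lemma mult_chars_gam (l : 'I_n) j : adj mult_chars (gam ^+ j : 'F_p) l = eta ^+ (l * j).
Proof.
have n0 := prim_order_gt0 etaP.
pose j0 := Ordinal (ltn_pmod j n0).
rewrite !mxE (bigD1 j0) //= !mxE /= (prim_expr_mod gamP) eqxx mulr1 big1 => [|i ni].
  rewrite addr0 rmorphXn /= conjcK -(prim_expr_mod etaP) modnMmr.
  by rewrite (prim_expr_mod etaP).
rewrite !mxE (eq_prim_root_expr gamP) -(inj_eq val_inj) /= in ni *.
by rewrite modn_small // (negPf ni) mulr0.
Qed.

Lemma mult_chars0 l : adj mult_chars (0 : 'F_p) l = 0.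
Proof.
rewrite !mxE big1 ?conjc0 // => i _; rewrite !mxE.
have n0 := prim_order_gt0 gamP.
have g0 : gam != 0 by rewrite (prim_root_eq0 gamP) -lt0n.
by rewrite (negPf (expf_neq0 _ g0)) mulr0.
Qed.

Lemma mult_chars_mul (l : 'I_n) i (x : 'F_p) :
  adj mult_chars (gam ^+ i * x) l = eta ^+ (l * i) * adj mult_chars x l.
Proof.
have [->|/Fp_unit_pow[j ->]] := eqVneq x 0; first by rewrite mulr0 mult_chars0 mulr0.
by rewrite -exprD !mult_chars_gam mulnDr exprD.
Qed.

(** The powers [gam ^+ j] with [j < n] are distinct, so the selection matrix has orthonormal rows;
    [n] terms equal to 1 remain. *)
Lemma mult_chars_norm l : (mult_chars *m adj mult_chars) l l = n%:R.
Proof.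
rewrite {2}/mult_chars adj_mulmx -mulmxA.
set s := fun j : 'I_n => (gam ^+ j : 'F_p); set B := \matrix_(i, j) _.
have -> : rowsub s 1%:M *m (adj (rowsub s 1%:M) *m adj B) = adj B.
  rewrite mulmxA; have -> : rowsub s 1%:M *m adj (rowsub s 1%:M) = 1%:M; last by rewrite mul1mx.
  apply/matrixP => i j; rewrite mul_rowsub_mx mul1mx !mxE /s (eq_prim_root_expr gamP).
  by rewrite !modn_small // conjc_nat -(inj_eq val_inj) eq_sym.
rewrite mxE (eq_bigr (fun=> 1)) ?sumr_const ?card_ord // => j _.
by rewrite !mxE rmorphXn /= conjcK -exprMn mulrC prim_root_mul_conjc expr1n.
Qed.

(** * The matrix of the oscillator transform *)

Variables (G : 'M['F_p]_2).
Hypotheses (detG : \det G = 1) (G01 : G 0 1 != 0).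
Local Notation W := (weil_kernel R G).

(** The factor [p] is the square norm of the rows of [W], the factor [n] that of the characters. *)
Definition osc_norm : C := real_complex R (Num.sqrt (p%:R * n%:R))^-1.

(** Columns of the adjoint are the prospective eigenvectors, so the matrix itself maps [f] to its
    products with them. *)
Definition osc_mx : 'M[C]_(n, dimF p) := osc_norm *: (mult_chars *m W).

Lemma adj_osc_mx : adj osc_mx = osc_norm *: (adj W *m adj mult_chars).
Proof.
by rewrite -adj_mulmx; apply/matrixP => x l; rewrite !mxE rmorphM /= oppr0.
Qed.

Lemma osc_mx_norm l : (osc_mx *m adj osc_mx) l l = 1.
Proof.
have n0 := prim_order_gt0 etaP; have p0 := prime_gt0 p_pr.
rewrite adj_osc_mx /osc_mx -scalemxAl -scalemxAr scalerA.
rewrite -mulmxA [W *m _]mulmxA weil_kernel_unitary // mul_scalar_mx -scalemxAr scalerA.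
rewrite mxE mult_chars_norm /osc_norm -rmorphM /= -expr2 exprVn sqr_sqrtr ?mulr_ge0 ?ler0n //.
rewrite fmorphV rmorphM /= !rmorph_nat -mulrA mulVf // mulf_neq0 // pnatr_eq0 -lt0n //.
Qed.

Lemma osc_mx_unit l : hdot (col l (adj osc_mx)) (col l (adj osc_mx)) = 1.
Proof.
rewrite -(osc_mx_norm l) mxE; apply: eq_bigr => x _.
by rewrite !mxE conjcK mulrC.
Qed.

Lemma osc_mx_transform l (f : 'cV_(dimF p)) :
  hdot f (col l (adj osc_mx)) = \sum_x osc_mx l x * f x 0.
Proof. by apply: eq_bigr => x _; rewrite !mxE conjcK mulrC. Qed.

(** The same [k] serves sizes [p] and [p - 1], as [2 * p <= 3 * (p - 1)] for [p >= 3]. *)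
Lemma slp_cost_osc_mx k : (p <= 2 ^ k)%N -> (2 ^ k <= 2 * p)%N -> (0 < k)%N ->
  slp_cost osc_mx (180 * (p * k)).
Proof.
move=> le_p le_k k0; have n0 := prim_order_gt0 gamP.
have p2 : (2 < p)%N by case: p p_pr p_odd => [|[|[|]]].
have eta0 : conjc eta != 0.
  by apply/eqP => e; have /eqP := prim_root_mul_conjc; rewrite e mulr0 eq_sym oner_eq0.
rewrite /osc_mx /mult_chars; apply: slp_costW.
  apply: slp_cost_scale; apply: slp_cost_mul; last first.
    by apply: (@slp_cost_weil_kernel R p p_pr p_odd k G); lia.
  apply: slp_cost_mul; last exact: slp_cost_select.
  by apply: (slp_cost_dft eta0 n0 _ _ k0); lia.
nia.
Qed.

Variables (rho : mx_representation C (SL2_group p) (dimF p))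
  (T : {group {'GL_2['F_p]}}).
Hypotheses (wr : weil_rep rho)
  (TP : forall t, t \in T -> t \in SL2 p /\
      exists2 a, a != 0 & G *m (GLval t : 'M['F_p]_2) = diag2 a *m G)
  (PT : forall a, a != 0 -> exists2 t, t \in T
      & G *m (GLval t : 'M['F_p]_2) = diag2 a *m G).

(** A given eigenvector serves only to find [l] and to express [chi]. It need not match the column
    itself: for the trivial character, a multiple of the delta function at 0 can be added to its
    image under [W]. *)
Lemma osc_mx_eigen (chi : {ffun [subg T] -> C}) : spectrum rho chi ->
  exists l, eigen rho chi (col l (adj osc_mx)).
Proof.
case=> _ ne.
have [phi phiE phi0] : exists2 phi, eigen rho chi phi & phi != 0.
  apply: contrapT => none; apply: ne; apply/seteqP; split=> phi.
    by move=> phiE; apply: contrapT => /eqP phi0; apply: none; exists phi.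
  by move=> -> t; rewrite mulmx0 scaler0.
have Wu := weil_kernel_unit R p_pr p_odd G01.
pose f := W *m phi.
have f0 : f != 0.
  by apply: contra phi0 => /eqP e; rewrite -(mulKmx Wu phi) -/f e mulmx0.
have [x0 fx0] : exists x, f x 0 != 0.
  apply: contrapT => none; move/negP: f0; apply; apply/eqP/colP => x; rewrite [RHS]mxE.
  by apply: contrapT => /eqP fx; apply: none; exists x.
have scale (t : [subg T]) a c : W *m rho (sgval t) = c *: (dilation R a *m W) ->
    forall x : 'F_p, c * f (a^-1 * x) 0 = chi t * f x 0.
  move=> e x; transitivity ((W *m (rho (sgval t) *m phi)) x 0).
    by rewrite mulmxA e -scalemxAl [RHS]mxE -mulmxA dilation_mulmx.
  by rewrite phiE -scalemxAr [LHS]mxE.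
have gam0 : gam != 0 by rewrite (prim_root_eq0 gamP) -lt0n (prim_order_gt0 gamP).
(* The torus element is the one with [a = gam^-1], because a dilation evaluates at [a^-1 * x]. *)
have [z zE] : exists z, forall x : 'F_p, f (gam * x) 0 = z * f x 0.
  have [|t tT Gt] := PT (a := gam^-1); first by rewrite invr_eq0.
  have gV : gam^-1 != 0 by rewrite invr_eq0.
  have [tS _] := TP tT.
  have [c c0 cE] := weil_rep_torus p_pr p_odd detG G01 wr tS gV Gt.
  exists (chi (subg T t) / c) => x; apply: (mulfI c0).
  have := @scale (subg T t) gam^-1 c; rewrite subgK // => /(_ cE x).
  by rewrite invrK => ->; rewrite mulrA mulrCA divff // mulr1.
have zX i (x : 'F_p) : f (gam ^+ i * x) 0 = z ^+ i * f x 0.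
  by elim: i => [|i IH]; rewrite ?expr0 ?mul1r // !exprS -!mulrA zE IH.
have zn : z ^+ n = 1.
  apply: (mulIf fx0); rewrite -zX (prim_expr_order gamP) !mul1r //.
have [l zl] := prim_rootP etaP zn.
exists l => t; have [tS [a a0 Gt]] := TP (subgP t).
have [c c0 cE] := weil_rep_torus p_pr p_odd detG G01 wr tS a0 Gt.
have [i ai] : exists i : 'I_n, a^-1 = gam ^+ i by apply: Fp_unit_pow; rewrite invr_eq0.
have chiE : chi t = c * eta ^+ (l * i).
  apply: (mulIf fx0); rewrite -(scale t a c cE) ai zX zl mulrA exprM //.
(* After applying the injective [W], the column becomes a multiple of a multiplicative character, on
   which dilations act by scalars. *)
apply: (can_inj (mulKmx Wu)).
have WE : W *m col l (adj osc_mx) = (osc_norm * p%:R) *: col l (adj mult_chars).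
  rewrite adj_osc_mx !colE -scalemxAl -scalemxAr !mulmxA weil_kernel_unitary //.
  by rewrite mul_scalar_mx -scalemxAl scalerA.
rewrite mulmxA cE -scalemxAl -mulmxA WE -scalemxAr -[RHS]scalemxAr WE !scalerA.
apply/colP => x; rewrite [LHS]mxE [RHS]mxE dilation_mulmx ai chiE.
rewrite [col _ _ (_ * _) _]mxE mult_chars_mul [col _ _ _ _]mxE.
by set N := osc_norm; set F := _ x l; ring.
Qed.
End Eigenvectors.

(** * Choice of eigenvectors and operation count *)

Theorem mainTheorem5 (R : realType) :
  exists2 c : R, 0 < c &
    forall (p : nat) (p_prime : prime p) (p_odd : odd p)
      (rho : mx_representation R[i] (SL2_group p) (dimF p))
      (T : {group {'GL_2['F_p]}}),
    weil_rep rho -> split_torus T ->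
    exists phi : {ffun [subg T] -> R[i]} -> 'cV[R[i]]_(dimF p),
      unit_eigenvectors rho phi /\
      exists P : seq (slp_step R[i]),
        (size P)%:R <= c * (p%:R * ln p%:R) /\
        slp_computes (spectrum rho) (osc_transform phi) P.
Proof.
have ln2 : 0 < ln 2 :> R by rewrite ln_gt0 // ltr1n.
(* The cost is [180 * (p * k)], with [k] at most twice the integer part of [ln p / ln 2]. *)
exists (360 / ln 2) => [|p p_pr p_odd rho T wr /split_torus_conj]; first by rewrite divr_gt0.
case=> G [detG G01 TP PT].
have p1 := prime_gt1 p_pr.
have [gam gamP] := Fp_prim_root p_pr.
have [eta etaP] : exists z : R[i], (p.-1).-primitive_root z.
  by apply: prim_root_exists; lia.
pose M := osc_mx gam eta G.
pose phi0 l := col l (map_mx (@conjc R) M^T).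
have eig (chi : {ffun [subg T] -> R[i]}) : spectrum rho chi -> exists l, eigen rho chi (phi0 l).
  exact: (osc_mx_eigen p_pr p_odd gamP etaP detG G01 wr TP PT).
have [l lP] : exists l : {ffun [subg T] -> R[i]} -> 'I_p.-1,
    forall chi, spectrum rho chi -> eigen rho chi (phi0 (l chi)).
  have n0 : (0 < p.-1)%N by lia.
  (* Outside the spectrum the index is an arbitrary default. *)
  have ex (chi : {ffun [subg T] -> R[i]}) : exists l, spectrum rho chi -> eigen rho chi (phi0 l).
    case: (pselect (spectrum rho chi)) => [/eig [l le]|nchi]; first by exists l.
    by exists (Ordinal n0) => /nchi.
  by exists (fun chi => projT1 (cid (ex chi))) => chi; case: (cid (ex chi)).
exists (phi0 \o l); split.
  by move=> chi chiS; split; [exact: lP | exact: osc_mx_unit].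
(* This is the exponent with [p <= 2 ^ k <= 2 * p]. *)
pose k := (trunc_log 2 p).+1.
have le_k : (2 ^ k <= 2 * p)%N.
  by rewrite expnS leq_mul2l trunc_logP // ltnW.
have le_p : (p <= 2 ^ k)%N by rewrite ltnW // trunc_log_ltn.
have MC := slp_cost_osc_mx p_pr p_odd gamP etaP G01 le_p le_k isT.
have [|P [r [sP wP rP PE]]] := MC (dimF p) (@nat_of_ord _); first exact: ltn_ord.
exists P; split.
  have k2 : (k <= 2 * trunc_log 2 p)%N.
    by have := trunc_log_max (isT : 1 < 2)%N (p1 : 2 ^ 1 <= p)%N; rewrite /k; lia.
  have lnp : (trunc_log 2 p)%:R * ln 2 <= ln p%:R :> R.
    rewrite mulr_natl -lnXn // ler_ln ?posrE ?exprn_gt0 ?ltr0n ?(ltnW p1) //.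
    by rewrite -natrX ler_nat trunc_logP // ltnW.
  have sz : (size P)%:R <= 360 * (p%:R * (trunc_log 2 p)%:R) :> R.
    rewrite -!natrM ler_nat (leq_trans sP) //; nia.
  apply: (le_trans sz); rewrite -[360 / _ * _]mulrA ler_pM2l //.
  rewrite mulrCA ler_pM2l ?ltr0n ?(ltnW p1) //.
  by rewrite mulrC ler_pdivlMr.
split=> // chi chiS; exists (r (l chi)) => // f.
rewrite PE; last by rewrite size_map size_enum_ord.
apply: etrans (esym (osc_mx_transform gam eta G (l chi) f)).
apply: eq_bigr => x _; congr (_ * _).
by rewrite (nth_map x) ?size_enum_ord // nth_ord_enum.
Qed.
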